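(* Let $G$ be a discrete finitely generated group and let $T\in\mathrm{Aut}(G)$. Suppose that for every $g\in G$ the set $R_g=\{x\in G\mid x^n=g\text{ for some } n\in\mathbb{N}\}$ is finite. Then the following are equivalent: (1) $T\in(\mathrm{NC})$. (2) $T$ acts distally on $\mathrm{Sub}^c_G$. (3) $T$ acts distally on $\mathrm{Sub}_G$. (4) $T^n=\mathrm{Id}$ for some $n\in\mathbb{N}$, where $\mathrm{Id}$ is the identity map of $G$. In particular, if $G$ is a discrete finitely generated group which is strongly root compact and $T\in\mathrm{Aut}(G)$, then (1)-(4) are equivalent.
   Context: $\mathbb{N}=\{1,2,\dots\}$. For a locally compact group $G$ with identity $e$, $\mathrm{Sub}_G$ is the compact space of all closed subgroups of $G$ with the Chabauty topology: a sub-basis is given by the sets $\{A\in\mathrm{Sub}_G\mid A\cap K=\emptyset\}$ ($K\subset G$ compact) and $\{A\in\mathrm{Sub}_G\mid A\cap U\ne\emptyset\}$ ($U\subset G$ open). $\mathrm{Sub}^c_G\subset\mathrm{Sub}_G$ is the subspace of closed cyclic subgroups. $T\in\mathrm{Aut}(G)$ acts on $\mathrm{Sub}_G$ by $H\mapsto T(H)$. A homeomorphism $T$ of a Hausdorff space $X$ acts distally on $X$ if for all $x\ne y$ in $X$ the closure of $\{(T^n(x),T^n(y))\mid n\in\mathbb{Z}\}$ in $X\times X$ does not meet the diagonal. $T\in\mathrm{Aut}(G)$ belongs to the class $(\mathrm{NC})$ if for every nontrivial closed cyclic subgroup $A$ of $G$ and every unbounded sequence $\{n_k\}\subset\mathbb{Z}$,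 $T^{n_k}(A)\not\to\{e\}$ in $\mathrm{Sub}_G$. A locally compact group $G$ is strongly root compact if for every compact $C\subset G$ there is a compact $C_0\subset G$ such that for every $n\in\mathbb{N}$, every finite sequence $\{x_1,\dots,x_n\}$ in $G$ with $x_n=e$ satisfying $Cx_iCx_j\cap Cx_{i+j}\neq\emptyset$ for all $i+j\le n$ is contained in $C_0$. *)

(* Defs.v *)
From HB Require Import structures.
From mathcomp Require Import all_boot all_order all_algebra.
From mathcomp Require Import finmap all_classical topology.

Set Implicit Arguments.
Unset Strict Implicit.
Unset Printing Implicit Defensive.

Local Open Scope group_scope.
Local Open Scope classical_set_scope.

HB.mixin Record isLocallyCompactGroup G & Group G & Topological G := {
  mulg_continuous : continuous (fun z : G * G => z.1 * z.2);
  invg_continuous : continuous (fun x : G => x^-1);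
  lcgroup_hausdorff : hausdorff_space G;
  lcgroup_locally_compact : locally_compact [set: G]
}.

#[short(type="lcGroupType")]
HB.structure Definition LocallyCompactGroup :=
  { G of isLocallyCompactGroup G & Group G & Topological G }.

#[short(type="discreteGroupType")]
HB.structure Definition DiscreteGroup :=
  { G of LocallyCompactGroup G & DiscreteTopology G }.

(* Any group with the discrete topology is a locally compact group, so
   [discreteGroupType] adds no condition to being a discrete group. *)
HB.factory Record Discrete_isLocallyCompactGroup G
  & Group G & DiscreteTopology G := {}.

HB.builders Context G & Discrete_isLocallyCompactGroup G.

Let mulg_cts : continuous (fun z : G * G => z.1 * z.2).
Proof.
move=> [x y] U; rewrite /= nbhs_principalE => /principal_filterP Uxy.
exists ([set x], [set y]) => /=.
  by split; rewrite nbhs_principalE; exact/principal_filterP.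
by case=> a b /= [-> ->].
Qed.

Let invg_cts : continuous (fun x : G => x^-1).
Proof.
move=> x U; rewrite /= !nbhs_principalE => /principal_filterP Ux.
exact/principal_filterP.
Qed.

Let lc : locally_compact [set: G].
Proof.
move=> x _; exists [set x]; last first.
  split; [exact: compact_set1|exact: discrete_closed].
by rewrite /within /= nbhs_principalE; exact/principal_filterP.
Qed.

HB.instance Definition _ := isLocallyCompactGroup.Build G
  mulg_cts invg_cts discrete_hausdorff lc.

HB.end.

Record homeo (X : topologicalType) := Homeo {
  homeo_fun :> X -> X;
  homeo_inv : X -> X;
  homeo_funK : cancel homeo_fun homeo_inv;
  homeo_invK : cancel homeo_inv homeo_fun;
  homeo_fun_continuous : continuous homeo_fun;
  homeo_inv_continuous : continuous homeo_inv
}.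

Definition zpower (X : topologicalType) (T : homeo X) (n : int) : X -> X :=
  match n with
  | Posz k => iter k T
  | Negz k => iter k.+1 (homeo_inv T)
  end.

Definition acts_distally (X : topologicalType) (T : homeo X) : Prop :=
  forall x y : X, x <> y ->
    closure [set (zpower T n x, zpower T n y) | n in [set: int]]
      `&` diagonal = set0.

Record aut (G : lcGroupType) := Aut {
  aut_homeo :> homeo G;
  autM : {morph aut_homeo : x y / x * y}
}.

Definition is_subgroup (G : groupType) (H : set G) : Prop :=
  [/\ H 1, (forall x y, H x -> H y -> H (x * y)) & (forall x, H x -> H x^-1)].

Record Sub (G : lcGroupType) := MkSub {
  sub_set :> set G;
  sub_closed : closed sub_set;
  sub_subgroup : is_subgroup sub_set
}.

Lemma Sub_inj (G : lcGroupType) (H K : Sub G) :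
  H = K :> set G -> H = K.
Proof.
case: H K => [H cH sH] [K cK sK] /= HK; case: _ / HK in cK sK *.
by congr MkSub; exact: Prop_irrelevance.
Qed.

Definition chabauty_subbasis (G : lcGroupType) : set (set (Sub G)) :=
  [set [set A : Sub G | A `&` K = set0] | K in [set K : set G | compact K]]
  `|`
  [set [set A : Sub G | A `&` U !=set0] | U in [set U : set G | open U]].

HB.instance Definition _ (G : lcGroupType) := gen_eqMixin (Sub G).
HB.instance Definition _ (G : lcGroupType) := gen_choiceMixin (Sub G).
HB.instance Definition _ (G : lcGroupType) :=
  isSubBaseTopological.Build (Sub G) (@chabauty_subbasis G) id.

Lemma is_subgroup1 (G : groupType) : is_subgroup [set 1 : G].
Proof.
by split=> // [x y -> ->|x ->] /=; rewrite ?mulg1 ?invg1.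
Qed.

Lemma closed_set1g (G : lcGroupType) : closed [set 1 : G].
Proof.
by apply: accessible_closed_set1; apply: hausdorff_accessible;
  exact: lcgroup_hausdorff.
Qed.

Definition trivial_Sub (G : lcGroupType) : Sub G :=
  MkSub (@closed_set1g G) (@is_subgroup1 G).

Definition zexpg (G : groupType) (x : G) (n : int) : G :=
  match n with
  | Posz k => x ^+ k
  | Negz k => x ^- k.+1
  end.

Definition is_cyclic (G : groupType) (H : set G) : Prop :=
  exists x, H = [set zexpg x n | n in [set: int]].

(* As a [set_type], it carries the subspace topology. *)
Definition cyclic_Sub (G : lcGroupType) : set (Sub G) :=
  [set H : Sub G | is_cyclic H].
Arguments cyclic_Sub : clear implicits.

Section SubAction.
Variable G : lcGroupType.
Implicit Types (T : aut G) (H : Sub G).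

Lemma aut_inv_morph T : {morph homeo_inv T : x y / x * y}.
Proof.
move=> x y; apply: (can_inj (homeo_funK T)).
by rewrite autM !homeo_invK.
Qed.

Definition inv_aut T : aut G :=
  @Aut G (Homeo (homeo_invK T) (homeo_funK T)
    (@homeo_inv_continuous _ T) (@homeo_fun_continuous _ T))
    (aut_inv_morph T).

Lemma aut_imageE T (A : set G) : T @` A = homeo_inv T @^-1` A.
Proof.
apply/seteqP; split=> [_ [x Ax <-]|x Ax] /=; first by rewrite homeo_funK.
by exists (homeo_inv T x) => //; rewrite homeo_invK.
Qed.

Lemma aut_image_closed T H : closed (T @` H).
Proof.
rewrite aut_imageE; apply: preimage_closed; last exact: sub_closed.
by move=> x _; exact: homeo_inv_continuous.
Qed.

Lemma aut1 T : T 1 = 1.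
Proof. by apply: (mulgI (T 1)); rewrite -autM !mulg1. Qed.

Lemma autV T x : T x^-1 = (T x)^-1.
Proof. by apply: (mulgI (T x)); rewrite -autM !mulgV aut1. Qed.

Lemma aut_image_subgroup T H : is_subgroup (T @` H).
Proof.
have [H1 HM HV] := sub_subgroup H; split.
- by exists 1; rewrite ?aut1.
- move=> _ _ [x Hx <-] [y Hy <-].
  by exists (x * y); [exact: HM|rewrite autM].
- by move=> _ [x Hx <-]; exists x^-1; [exact: HV|rewrite autV].
Qed.

Definition Sub_image T H : Sub G :=
  MkSub (@aut_image_closed T H) (@aut_image_subgroup T H).

Lemma Sub_imageK T : cancel (Sub_image T) (Sub_image (inv_aut T)).
Proof.
move=> H; apply: Sub_inj => /=; rewrite image_comp.
rewrite (_ : _ \o _ = id) ?image_id //.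
by apply/funext => x /=; exact: homeo_funK.
Qed.

Lemma Sub_imageVK T : cancel (Sub_image (inv_aut T)) (Sub_image T).
Proof.
move=> H; apply: Sub_inj => /=; rewrite image_comp.
rewrite (_ : _ \o _ = id) ?image_id //.
by apply/funext => x /=; exact: homeo_invK.
Qed.

Lemma open_chabauty_subbasis (B : set (Sub G)) :
  chabauty_subbasis B -> open B.
Proof.
move=> sB; exists [set B]; last by rewrite bigcup_set1.
move=> _ ->; exists [fset B]%fset.
  by move=> C /= /fset1P ->; exact: mem_set.
apply/seteqP; split=> [A /(_ B)|A BA C /fset1P ->//].
by apply; exact/fset1P.
Qed.

Lemma Sub_image_subbasis T (B : set (Sub G)) :
  chabauty_subbasis B -> chabauty_subbasis (Sub_image T @^-1` B).
Proof.
move=> [[K cK <-]|[U oU <-]]; [left|right].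
- exists (homeo_inv T @` K).
    apply: continuous_compact => //; apply: continuous_subspaceT.
    exact: homeo_inv_continuous.
  apply/seteqP; split=> A /= AK; rewrite -subset0 => x /=.
  + move=> [[y Ay <-] KTy]; suff : (A `&` homeo_inv T @` K) y by rewrite AK.
    by split=> //; exists (T y) => //; rewrite homeo_funK.
  + move=> [Ax [y Ky yx]]; suff : (T @` A `&` K) y by rewrite AK.
    by split=> //; exists x => //; rewrite -yx homeo_invK.
- exists (T @^-1` U).
    by move/continuousP: (@homeo_fun_continuous _ T); apply.
  apply/seteqP; split=> A /=.
  + by move=> [x [Ax UTx]]; exists (T x); split=> //; exists x.
  + by move=> [_ [[x Ax <-] UTx]]; exists x.
Qed.

Lemma Sub_image_continuous T : continuous (Sub_image T).
Proof.
apply/continuousP => _ [D sD <-].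
rewrite preimage_bigcup; apply: bigcup_open => _ /sD [F sF <-].
rewrite preimage_bigcap openE => A FA; apply: filter_bigI => B BF.
apply: open_nbhs_nbhs; split; last exact: FA.
by apply: open_chabauty_subbasis; apply: Sub_image_subbasis; exact/set_mem/sF.
Qed.

Definition Sub_homeo T : homeo (Sub G) :=
  Homeo (@Sub_imageK T) (@Sub_imageVK T)
    (@Sub_image_continuous T) (@Sub_image_continuous (inv_aut T)).

Lemma autX T x n : T (x ^+ n) = T x ^+ n.
Proof. by elim: n => [|n IHn]; rewrite ?expg0 ?aut1 // !expgS autM IHn. Qed.

Lemma aut_zexpg T x n : T (zexpg x n) = zexpg (T x) n.
Proof. by case: n => n /=; rewrite ?autV autX. Qed.

Lemma Sub_image_cyclic T H : is_cyclic H -> is_cyclic (Sub_image T H).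
Proof.
move=> [x Hx]; exists (T x); rewrite /= Hx image_comp.
by apply: eq_imagel => n _ /=; rewrite aut_zexpg.
Qed.

Definition cyclic_Sub_image T (H : cyclic_Sub G) : cyclic_Sub G :=
  exist _ (Sub_image T (val H))
    (mem_set (Sub_image_cyclic T (set_mem (valP H)))).

Lemma cyclic_Sub_imageK T :
  cancel (cyclic_Sub_image T) (cyclic_Sub_image (inv_aut T)).
Proof. by move=> H; apply: val_inj; exact: Sub_imageK. Qed.

Lemma cyclic_Sub_imageVK T :
  cancel (cyclic_Sub_image (inv_aut T)) (cyclic_Sub_image T).
Proof. by move=> H; apply: val_inj; exact: Sub_imageVK. Qed.

Lemma cyclic_Sub_image_continuous T : continuous (cyclic_Sub_image T).
Proof.
apply: continuous_comp_initial => H.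
apply: (@continuous_comp _ _ _ set_val (Sub_image T)).
  exact: initial_continuous.
exact: Sub_image_continuous.
Qed.

Definition cyclic_Sub_homeo T : homeo (cyclic_Sub G) :=
  Homeo (@cyclic_Sub_imageK T) (@cyclic_Sub_imageVK T)
    (@cyclic_Sub_image_continuous T)
    (@cyclic_Sub_image_continuous (inv_aut T)).

End SubAction.

Definition unbounded_seq (u : nat -> int) : Prop :=
  ~ exists M : nat, forall k, (absz (u k) <= M)%N.

Definition NC (G : lcGroupType) (T : aut G) : Prop :=
  forall A : Sub G, is_cyclic A -> A <> trivial_Sub G ->
  forall u : nat -> int, unbounded_seq u ->
    ~ ((fun k => zpower (Sub_homeo T) (u k) A) @ \oo --> trivial_Sub G).

Definition finitely_generated (G : groupType) : Prop :=
  exists2 S : set G, finite_set S &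
    forall H : set G, is_subgroup H -> S `<=` H -> H = setT.

Definition root_set (G : groupType) (g : G) : set G :=
  [set x | exists2 n : nat, (0 < n)%N & x ^+ n = g].

(* The finite sequence x_1, ..., x_n is given by the values on 1, ..., n of a
   function on nat; its other values are irrelevant. *)
Definition strongly_root_compact (G : lcGroupType) : Prop :=
  forall C : set G, compact C ->
  exists2 C0 : set G, compact C0 &
    forall (n : nat) (x : nat -> G), (0 < n)%N -> x n = 1 ->
      (forall i j : nat, (0 < i)%N -> (0 < j)%N -> (i + j <= n)%N ->
         [set c * x i * c' * x j | c in C & c' in C]
           `&` [set c * x (i + j)%N | c in C] !=set0) ->
      forall i : nat, (0 < i <= n)%N -> C0 (x i).

(* Main.v *)
(* (1) => (4): if the iterates T^k(x) were pairwise distinct then, R_g being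
   finite, each g <> 1 would lie in T^k(<x>) = <T^k(x)> for only finitely many
   k, since either T^k(x) or its inverse lies in R_g.  Hence T^k(<x>) would
   converge to the trivial subgroup, against (NC).  So every element is
   T-periodic, and a common period for the elements of a finite generating set
   is a period of T.
   For a strongly root compact G, a root y of g with y^n = g gives the sequence
   y, y^2, ..., y^(n-1), 1, admissible for C = {1, g}; hence R_g is finite. *)
Require Import Defs.
From mathcomp Require Import all_boot all_order all_algebra.
From mathcomp Require Import finmap all_classical topology.

Set Implicit Arguments.
Unset Strict Implicit.
Unset Printing Implicit Defensive.

Local Open Scope group_scope.
Local Open Scope classical_set_scope.

(** * Preliminaries on iteration, finiteness and separation *)

Lemma iter_modn (X : Type) (f : X -> X) n k :
  iter n f =1 id -> iter (k %% n) f =1 iter k f.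
Proof.
move=> fn x; rewrite [in RHS](divn_eq k n) addnC iterD iterM.
by congr (iter _ f _); rewrite iter_fix.
Qed.

Lemma near_infty_notin (A : set nat) :
  finite_set A -> \forall k \near \oo, ~ A k.
Proof.
move=> /finite_fsetP[X ->]; near=> k => /= kX.
have : (k <= \max_(i <- X) i)%N by rewrite (leq_bigmax_seq (F := id)).
by rewrite leqNgt; apply/negP/negPn; near: k; exact: nbhs_infty_gt.
Unshelve. all: end_near. Qed.

(** Compactness is used along the filter generated by the families of supersets of finite sets: each
    point lies in all large enough sets, so by near-covering all of [K] does, and such a set can be
    taken finite. *)
Lemma discrete_compact_finite (X : discreteTopologicalType) (K : set X) :
  compact K -> finite_set K.
Proof.
move=> /compact_near_coveringP cK.
have FF : Filter (filter_from (@finite_set X) (fun A => [set B | A `<=` B])).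
  apply: filter_from_filter; first by exists set0.
  move=> A B fA fB; exists (A `|` B); first by rewrite finite_setU.
  by move=> C /=; rewrite subUset.
have [x _|A fA] := cK _ _ (fun B x => B x) FF; last first.
  by move=> /(_ A (@subset_refl _ _)) KA; exact: sub_finite_set KA fA.
exists ([set x], [set B | B x]); last by case=> a B /= [->].
split; first exact: discrete_set1.
by exists [set x] => // B /(_ x); apply.
Qed.

Lemma accessible_prod (X Y : topologicalType) :
  accessible_space X -> accessible_space Y -> accessible_space (X * Y)%type.
Proof.
move=> aX aY [a b] [c d]; rewrite xpair_eqE negb_and => /orP[/aX|/aY].
- move=> [U [oU /set_mem Ua /set_mem Uc]]; exists (fst @^-1` U).
  split; [|exact/mem_set|exact/mem_set].
  by apply: open_comp => // p _; exact: cvg_fst.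
- move=> [U [oU /set_mem Ub /set_mem Ud]]; exists (snd @^-1` U).
  split; [|exact/mem_set|exact/mem_set].
  by apply: open_comp => // p _; exact: cvg_snd.
Qed.

(** * Distality of a single homeomorphism *)

Section Distal.
Variables (X : topologicalType) (T : homeo X).

(** With period [n] the inverse of [T] is its iterate of order [n.-1], so negative powers too reduce
    modulo [n]. *)
Lemma zpower_periodic n : (0 < n)%N -> iter n T =1 id ->
  forall m, exists2 k, (k < n)%N & zpower T m =1 iter k T.
Proof.
move=> n0 Tn; case=> [k|k] /=.
  by exists (k %% n)%N; [rewrite ltn_mod|move=> x; rewrite iter_modn].
have invE : homeo_inv T =1 iter n.-1 T.
  by move=> x; rewrite -{1}(Tn x) -(prednK n0) iterS homeo_funK.
exists (k.+1 * n.-1 %% n)%N; first by rewrite ltn_mod.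
move=> x; rewrite iter_modn// iterM; exact: (eq_iter invE k.+1).
Qed.

Lemma zpower_inj m : injective (zpower T m).
Proof.
case: m => k x y /=; last first.
  move/(can_inj (homeo_invK T)).
  by elim: k => [//|k IH] /= /(can_inj (homeo_invK T)).
by elim: k => [//|k IH] /= /(can_inj (homeo_funK T)).
Qed.

(** The orbit of the pair is finite, hence closed in the T1 space [X * X]; it misses the diagonal
    because powers of [T] are injective. *)
Lemma periodic_acts_distally n : accessible_space X ->
  (0 < n)%N -> iter n T =1 id -> acts_distally T.
Proof.
move=> aX n0 Tn x y xy.
pose E := [set (zpower T m x, zpower T m y) | m in [set: int]].
have fE : finite_set E.
  apply: (@sub_finite_set _ _ [set (iter k T x, iter k T y) | k in `I_n]).
    move=> _ [m _ <-]; have [k kn Tm] := zpower_periodic n0 Tn m.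
    by exists k => //; rewrite !Tm.
  exact: finite_image.
have cE : closed E.
  by move/accessible_finite_set_closed: (accessible_prod aX aX); apply.
rewrite -/E -(closure_id E).1// -subset0 => _ [[m _ <-]].
by move=> /zpower_inj.
Qed.

(** The common limit puts the diagonal point [(z, z)] in the closure of the orbit of [(x, y)]. *)
Lemma acts_distally_cvg_eq (x y z : X) (u : nat -> int) :
  acts_distally T ->
  (fun k => zpower T (u k) x) @ \oo --> z ->
  (fun k => zpower T (u k) y) @ \oo --> z -> x = y.
Proof.
move=> dT xz yz; apply: contrapT => /dT; apply/eqP/set0P.
exists (z, z); split => // B zB.
have [k Bk] : exists k, B (zpower T (u k) x, zpower T (u k) y).
  exact: (@filter_ex _ \oo _ _ (cvg_pair xz yz zB)).
by exists (zpower T (u k) x, zpower T (u k) y); split=> //; exists (u k).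
Qed.

End Distal.

(** * Chabauty convergence and the induced actions *)

Section Chabauty.
Variable G : lcGroupType.
Implicit Types (T : aut G) (A H : Defs.Sub G).

(** A neighbourhood contains a finite intersection of subbasic sets around [H], and filters are
    stable under these. *)
Lemma cvg_chabauty (F : set_system (Defs.Sub G)) H : Filter F ->
  (forall B, chabauty_subbasis B -> B H -> F B) -> F --> H.
Proof.
move=> FF FB U; rewrite nbhsE => -[_ [[D sD <-] [E DE EH]]].
move/filterS; apply; apply: (@filterS _ F FF E); first by move=> A EA; exists E.
have [X sX XE] := sD _ DE; rewrite -XE in EH *.
apply: filter_bigI => B BX; apply: FB; last exact: EH.
exact/set_mem/sX.
Qed.

Lemma iter_Sub_homeoE T k A : iter k (Sub_homeo T) A = iter k T @` A :> set G.
Proof.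
elim: k => [|k IH] /=; first by rewrite image_id.
by rewrite IH image_comp.
Qed.

Lemma iter_Sub_homeo_id T n :
  iter n T =1 id -> iter n (Sub_homeo T) =1 id.
Proof.
move=> Tn A; apply: Sub_inj; rewrite iter_Sub_homeoE.
by rewrite (_ : iter n T = id) ?image_id//; exact/funext.
Qed.

Lemma zpower_trivial_Sub T m :
  zpower (Sub_homeo T) m (trivial_Sub G) = trivial_Sub G.
Proof.
have fixT S : Sub_image S (trivial_Sub G) = trivial_Sub G.
  by apply: Sub_inj; rewrite /= image_set1 aut1.
by case: m => k; apply: iter_fix; exact: fixT.
Qed.

Lemma is_cyclic_trivial_Sub : is_cyclic (trivial_Sub G).
Proof.
exists 1; apply/seteqP; split=> [_ ->|_ [n _ <-]] /=; first by exists 0%R.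
by case: n => k /=; rewrite expg1n ?invg1.
Qed.

Lemma set_val_zpower T m (A : cyclic_Sub G) :
  set_val (zpower (cyclic_Sub_homeo T) m A) =
  zpower (Sub_homeo T) m (set_val A).
Proof.
by case: m => k; elim: k => // k IH; exact: (congr1 (Sub_image _) IH).
Qed.

(** The inclusion of the cyclic subgroups is injective, continuous and equivariant, so it carries a
    diagonal limit point to a diagonal limit point. *)
Lemma acts_distally_cyclic_Sub T :
  acts_distally (Sub_homeo T) -> acts_distally (cyclic_Sub_homeo T).
Proof.
move=> dT A B AB; rewrite -subset0 => -[C D] [ECD CD].
have {CD} CD : C = D := CD; subst D.
have vAB : set_val A <> set_val B by move=> /val_inj.
have := dT _ _ vAB; rewrite -subset0.
move=> /(_ (set_val C, set_val C)); apply; split=> //.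
move=> W [[P Q] /= [PC QC] PQW].
have [|_ [[n _ <-] [Pn Qn]]] := ECD (set_val @^-1` P `*` set_val @^-1` Q).
  exists (set_val @^-1` P, set_val @^-1` Q) => //=.
  by split; exact: initial_continuous.
exists (zpower (Sub_homeo T) n (set_val A), zpower (Sub_homeo T) n (set_val B)).
split; first by exists n.
by apply: PQW; split; rewrite /= -set_val_zpower.
Qed.

(** The trivial subgroup is cyclic and fixed by the action, so an orbit sequence of [A] tending to
    it shares its limit with a constant orbit. *)
Lemma acts_distally_NC T : acts_distally (cyclic_Sub_homeo T) -> NC T.
Proof.
move=> dT A cA A1 u _ uA; apply: A1.
have [cA' c1] := (mem_set cA : A \in cyclic_Sub G,
  mem_set is_cyclic_trivial_Sub : trivial_Sub G \in cyclic_Sub G).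
pose a : cyclic_Sub G := exist _ A cA'.
pose e : cyclic_Sub G := exist _ (trivial_Sub G) c1.
suff : a = e by move=> /(congr1 set_val).
have cvg_val b : (fun k => zpower (Sub_homeo T) (u k) (set_val b)) @ \oo -->
    trivial_Sub G -> (fun k => zpower (cyclic_Sub_homeo T) (u k) b) @ \oo --> e.
  move=> bW U [_ [[W oW <-] We /filterS]]; apply.
  have /bW : nbhs (trivial_Sub G) W by exact: open_nbhs_nbhs.
  by apply: (@filterS _ \oo) => k /=; rewrite -set_val_zpower.
apply: (acts_distally_cvg_eq (z := e) dT (cvg_val a uA)).
apply: cvg_val; rewrite /= (_ : (fun _ => _) = cst (trivial_Sub G)).
  exact: cvg_cst.
by apply/funext => k; rewrite zpower_trivial_Sub.
Qed.

End Chabauty.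

(** * Discrete groups: separation, periodicity and roots *)

Section DiscreteGroup.
Variable G : discreteGroupType.
Implicit Types (T : aut G) (x g : G).

(** A singleton is both open and compact, so containing [g] and avoiding [g] are both open
    conditions on a subgroup. *)
Lemma accessible_Sub : accessible_space (Defs.Sub G).
Proof.
suff sep (A B : Defs.Sub G) : A <> B -> exists U, [/\ open U, U A & ~ U B].
  move=> A B /eqP /sep[U [oU UA UB]]; exists U.
  by split=> //; exact: mem_set.
move=> AB.
have [g] : exists g, ~ ((A : set G) g <-> (B : set G) g).
  apply/existsNP => AEB; apply/AB/Sub_inj/funext => g; apply/propext/AEB.
have meet1 (H : Defs.Sub G) : (H `&` [set g] !=set0) = (H : set G) g.
  by apply/propext; split=> [[_ [? <-]]//|Hg]; exists g.
have [Ag nAB|nAg nAB] := pselect ((A : set G) g).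
- exists [set H : Defs.Sub G | H `&` [set g] !=set0]; split.
  + apply: open_chabauty_subbasis; right; exists [set g] => //.
    exact: discrete_open.
  + by rewrite /= meet1.
  + by rewrite /= meet1; tauto.
- exists [set H : Defs.Sub G | H `&` [set g] = set0]; split.
  + apply: open_chabauty_subbasis; left; exists [set g] => //.
    exact: compact_set1.
  + by rewrite /= -subset0 => h [Ah hg]; apply: nAg; rewrite -hg.
  + move=> /= B0; have : (B : set G) g by apply: contrapT; tauto.
    by rewrite -meet1 B0 => -[].
Qed.

(** Subgroups always meet an open set containing 1, so only the compact sets avoiding 1 matter;
    compactness makes the pointwise escape uniform on them. *)
Lemma cvg_trivial_Sub (u : nat -> Defs.Sub G) :
  (forall g, g <> 1 -> \forall k \near \oo, ~ (u k : set G) g) ->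
  u @ \oo --> trivial_Sub G.
Proof.
move=> ug; apply: cvg_chabauty => B [[K cK <-]|[U oU <-]] /=.
- move=> K1; have nK1 : ~ K 1.
    by move=> ?; have : ([set 1] `&` K) (1 : G) by []; rewrite K1.
  have near_disj : \forall k \near \oo, K `<=` [set g | ~ (u k : set G) g].
    move/compact_near_coveringP: cK; apply=> g Kg.
    have /ug : g <> 1 by move=> g1; apply: nK1; rewrite -g1.
    move=> ukg; exists ([set g], [set k | ~ (u k : set G) g]).
      by split => //; exact: discrete_set1.
    by case=> h k /= [->].
  apply: filterS near_disj => k Kk /=; rewrite -subset0 => g [ukg Kg].
  exact: Kk ukg.
- move=> [_ [-> U1]]; apply: (@filterE _ \oo _) => k; exists 1; split=> //.
  by have [] := sub_subgroup (u k).
Qed.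

(** Quotients of natural powers spare the sign analysis when proving closure under products. *)
Lemma range_zexpgE x :
  [set zexpg x n | n in [set: int]] =
  [set g | exists a b, g = x ^+ a * x ^- b].
Proof.
apply/seteqP; split=> [_ [[k|k] _ <-]|_ [a [b ->]]] /=.
- by exists k, 0%N; rewrite expg0 invg1 mulg1.
- by exists 0%N, k.+1; rewrite expg0 mul1g.
- have [ba|ab] := leqP b a.
    by exists (Posz (a - b)) => //=; rewrite expgnFr.
  exists (Negz (b - a).-1) => //=.
  by rewrite prednK ?subn_gt0// expgnFr 1?ltnW// invgM invgK.
Qed.

Lemma is_subgroup_cyclic x : is_subgroup [set zexpg x n | n in [set: int]].
Proof.
have cx a b : commute (x ^+ a) (x ^- b).
  exact/commuteV/commuteX2/commute_refl.
rewrite range_zexpgE; split.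
- by exists 0%N, 0%N; rewrite expg0 invg1 mulg1.
- move=> _ _ [a [b ->]] [c [d ->]]; exists (a + c)%N, (d + b)%N.
  by rewrite !expgnDr invgM !mulgA -(mulgA _ _ (x ^+ c)) -cx !mulgA.
- by move=> _ [a [b ->]]; exists b, a; rewrite invgM invgK.
Qed.

Definition cyclic_subgroup x : Defs.Sub G :=
  MkSub (@discrete_closed G _) (is_subgroup_cyclic x).

Lemma iter_cyclic_subgroupE T k x :
  iter k (Sub_homeo T) (cyclic_subgroup x) =
  [set zexpg (iter k T x) n | n in [set: int]] :> set G.
Proof.
elim: k => //= k ->; rewrite image_comp.
by apply: eq_imagel => n _ /=; rewrite aut_zexpg.
Qed.

Lemma NC_periodic_point T :
  (forall g, finite_set (root_set g)) -> NC T ->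
  forall x, exists2 n, (0 < n)%N & iter n T x = x.
Proof.
move=> fR ncT x; apply: contrapT => nper.
have iterTI : injective (fun k => iter k T x).
  move=> a b /=; wlog ab : a b / (a < b)%N.
    by move=> W; have [/W|/W WW /esym/WW|] := ltngtP a b.
  rewrite -(subnKC (ltnW ab)) iterD => Tab; exfalso; apply: nper.
  exists (b - a)%N; first by rewrite subn_gt0.
  exact/esym/(@zpower_inj _ T (Posz a)).
have x1 : cyclic_subgroup x <> trivial_Sub G.
  move=> /(congr1 (@sub_set G)) /= xE; apply: nper; exists 1%N => //=.
  have : [set 1 : G] x by rewrite -xE; exists 1%R.
  by move=> ->; exact: aut1.
apply: (ncT (cyclic_subgroup x) _ x1 Posz); first by exists x.
  by move=> [M] /(_ M.+1); rewrite /= ltnn.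
apply: cvg_trivial_Sub => g g1.
(* The two root sets account for the positive and the negative exponents; exponent 0 would give
   [g = 1]. *)
have fA : finite_set (root_set g `|` root_set g^-1).
  by rewrite finite_setU.
have := near_infty_notin (finite_preimage (in2W iterTI) fA).
apply: filterS => k kR /=; rewrite iter_cyclic_subgroupE => -[[[|n]|n] _ /=].
- by rewrite expg0 => /esym.
- by move=> Tg; apply: kR; left; exists n.+1.
- by move=> Tg; apply: kR; right; exists n.+1 => //; rewrite -Tg invgK.
Qed.

Lemma NC_periodic T : finitely_generated G ->
  (forall g, finite_set (root_set g)) -> NC T ->
  exists2 n, (0 < n)%N & iter n T =1 id.
Proof.
move=> [S fS genS] fR ncT.
have /choice[f fP] : forall x, exists n, (0 < n)%N /\ iter n T x = x.
  by move=> x; have [n] := NC_periodic_point fR ncT x; exists n.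
pose N := (\prod_(s <- fset_set S) f s)%N.
exists N; first by apply: prodn_gt0 => s; have [] := fP s.
(* The fixed points of [iter N T] form a subgroup, which contains [S] because each [f s] divides
   [N]. *)
pose P : set G := [set x | iter N T x = x].
suff PT : P = setT by move=> x; have : P x by rewrite PT.
have iterMg k : {morph iter k T : x y / x * y}.
  by elim: k => // k IH x y /=; rewrite IH autM.
apply: genS.
- split=> [|x y Px Py|x Px]; rewrite /P /=.
  + by rewrite iter_fix// aut1.
  + by rewrite iterMg Px Py.
  + by apply: (mulgI x); rewrite -{1}Px -iterMg mulgV iter_fix// aut1.
- move=> s Ss; rewrite /P /= /N (big_rem s) /=; last first.
    by rewrite in_fset_set//; exact: mem_set.
  by rewrite mulnC iterM iter_fix//; have [] := fP s.
Qed.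

Lemma strongly_root_compact_finite_root_set g :
  strongly_root_compact G -> finite_set (root_set g).
Proof.
move=> /(_ [set 1; g]) []; first by apply: finite_compact; exact: finite_set2.
move=> C0 cC0 rootC0.
(* For exponent 1 the sequence reduces to [x 1 = 1] and does not see the root, which is [g] itself;
   hence the extra point. *)
have fC0 : finite_set (C0 `|` [set g]).
  by rewrite finite_setU; split => //; exact: discrete_compact_finite.
apply: sub_finite_set fC0 => y [[//|[|n]] _ yn].
  by right; rewrite -yn expg1.
left; pose x i := if (i < n.+2)%N then y ^+ i else 1.
suff : C0 (x 1%N) by rewrite /x /= expg1.
apply: (rootC0 n.+2) => // [|i j i0 j0]; first by rewrite /x ltnn.
(* At [i + j = n.+2] the product of powers is [g] while [x (i + j)] is 1, so the factor [g] of [C]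
   is taken on the right; below that, all factors are 1. *)
rewrite leq_eqVlt => /orP[/eqP ijn|ijn].
- have [iN jN] : (i < n.+2)%N /\ (j < n.+2)%N.
    by rewrite -ijn -[X in (X < _)%N]addn0 ltn_add2l j0
       -[X in (X < _)%N]add0n ltn_add2r.
  exists g; split; last by exists g; [right|rewrite /x ijn ltnn mulg1].
  exists 1; [by left|exists 1; [by left|]].
  by rewrite /x iN jN !mul1g mulg1 -expgnDr ijn.
- have [iN jN] : (i < n.+2)%N /\ (j < n.+2)%N.
    by split; apply: leq_ltn_trans ijn; rewrite (leq_addr, leq_addl).
  exists (y ^+ (i + j)); split; last first.
    by exists 1; [left|rewrite /x ijn mul1g].
  exists 1; [by left|exists 1; [by left|]].
  by rewrite /x iN jN !mul1g mulg1 -expgnDr.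
Qed.

End DiscreteGroup.

Theorem proposition3p8 (G : discreteGroupType) (T : aut G)
    (hfg : finitely_generated G) :
  ((forall g : G, finite_set (root_set g)) ->
     [<-> NC T;
          acts_distally (cyclic_Sub_homeo T);
          acts_distally (Sub_homeo T);
          exists2 n : nat, (0 < n)%N & iter n T =1 id])
  /\
  (strongly_root_compact G ->
     [<-> NC T;
          acts_distally (cyclic_Sub_homeo T);
          acts_distally (Sub_homeo T);
          exists2 n : nat, (0 < n)%N & iter n T =1 id]).
Proof.
set stmt := (X in (_ -> X) /\ _).
suff main : (forall g : G, finite_set (root_set g)) -> stmt.
  by split=> // src; apply: main => g; exact: strongly_root_compact_finite_root_set.
move=> fR.
(* Passing through periodicity, this serves two of the implications in the cycle. *)
have NC_Sub : NC T -> acts_distally (Sub_homeo T).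
  move=> /(NC_periodic hfg fR)[n n0 Tn].
  apply: (periodic_acts_distally (@accessible_Sub G) n0).
  exact: iter_Sub_homeo_id.
tfae.
- by move=> /NC_Sub/acts_distally_cyclic_Sub.
- by move=> /acts_distally_NC/NC_Sub.
- by move=> /acts_distally_cyclic_Sub/acts_distally_NC/(NC_periodic hfg fR).
- move=> [n n0 Tn]; apply/acts_distally_NC/acts_distally_cyclic_Sub.
  apply: (periodic_acts_distally (@accessible_Sub G) n0).
  exact: iter_Sub_homeo_id.
Qed.
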